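(* Let $G$ be a group and $\mu\in L(G)$. Let $\eta, \nu \in L(\mu)$ and let $a \in L$ be such that $\mathrm{tip}(\nu) = a \wedge \mathrm{tip}(\eta)$. Let $z\in G$ be such that $a_z\in\mu$. Then $\nu=\eta^{a_z}$ if and only if $\nu_t = (\eta_t)^{z^{-1}}$ for all $t \in L$ with $t \leq \mathrm{tip}(\nu)$.
   Context: $L=\langle L,\le,\vee,\wedge\rangle$ is a completely distributive (complete) lattice with greatest element $1$ and least element $0$. An $L$-subset of $G$ is a function $G\to L$; $\eta\subseteq\mu$ means $\eta(x)\le\mu(x)$ for all $x\in G$. An $L$-subset $\mu$ of $G$ is an $L$-subgroup of $G$ if $\mu(xy)\ge\mu(x)\wedge\mu(y)$ and $\mu(x^{-1})=\mu(x)$ for all $x,y\in G$; $L(G)$ is the set of $L$-subgroups of $G$. For $\mu\in L(G)$, $L(\mu)$ denotes the set of $\eta\in L(G)$ with $\eta\subseteq\mu$. The tip of an $L$-subset $\eta$ is $\mathrm{tip}(\eta)=\bigvee_{x\in G}\eta(x)$ (for an $L$-subgroup it equals $\eta(e)$, $e$ the identity of $G$). For $t\in L$ the level subset is $\eta_t=\{x\in G\mid \eta(x)\ge t\}$. For $a\in L$ and $z\in G$, the $L$-point $a_z$ is the $L$-subset with value $a$ at $z$ and $0$ elsewhere; $a_z\in\mu$ means $\mu(z)\ge a$. For $\eta\in L(\mu)$ and $a_z\in\mu$, the conjugate of $\eta$ by $a_z$ is $\eta^{a_z}(x)=a\wedge\eta(zxz^{-1})$ for all $x\in G$. For a subgroup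 $K$ of $G$ and $g\in G$, $K^{g}=gKg^{-1}$; thus $(\eta_t)^{z^{-1}}=z^{-1}\eta_t z$. *)

(* Defs.v *)
From mathcomp Require Import all_boot all_order.
From mathcomp Require Import boolp classical_sets.

Set Implicit Arguments.
Unset Strict Implicit.
Unset Printing Implicit Defensive.

Local Open Scope classical_set_scope.

Section CompletelyDistributive.
Context {d : Order.disp_t} {L : tbLatticeType d}.

Definition lsup (A : set L) : L := supremum \bot%O A.
Definition linf (A : set L) : L := infimum \top%O A.

Definition complete_lattice : Prop :=
  forall A : set L, supremums A !=set0 /\ infimums A !=set0.

(* The inner set on the right ranges over the choice functions of the family
   (A i), i.e. those f : I -> L with f i in A i for every i. *)
Definition completely_distributive : Prop :=
  complete_lattice /\
  forall (I : Type) (A : I -> set L),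
    linf [set lsup (A i) | i in [set: I]] =
    lsup [set linf (range f) | f in [set f : I -> L | forall i, A i (f i)]].

End CompletelyDistributive.

Arguments complete_lattice {d} L.
Arguments completely_distributive {d} L.

Section LSubsets.
Context {d : Order.disp_t} {L : tbLatticeType d} {G : groupType}.

Definition lsubset (eta mu : G -> L) : Prop := forall x, (eta x <= mu x)%O.

Definition lsubgroup : set (G -> L) := [set mu |
  (forall x y, (mu x `&` mu y <= mu (x * y)%g)%O) /\
  (forall x, mu (x^-1)%g = mu x)].

Definition lsubgroup_of (mu : G -> L) : set (G -> L) :=
  [set eta | lsubgroup eta /\ lsubset eta mu].

Definition tip (eta : G -> L) : L := lsup (range eta).

Definition level (eta : G -> L) (t : L) : set G := [set x | (t <= eta x)%O].

(* The L-point a_z is given by its value a and its support z, since the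
   function alone does not determine z when a = 0. *)
Definition lpoint_mem (a : L) (z : G) (mu : G -> L) : Prop := (a <= mu z)%O.

Definition lconj (eta : G -> L) (a : L) (z : G) : G -> L :=
  fun x => (a `&` eta (z * x * z^-1)%g)%O.

(* K^g = g K g^-1; MathComp's conjugation x ^ g is g^-1 x g. *)
Definition set_conj (K : set G) (g : G) : set G :=
  [set (g * x * g^-1)%g | x in K].

End LSubsets.

(* Main.v *)
(* For t <= a the inequality t <= a /\ eta(z x z^-1) reduces to
   t <= eta(z x z^-1), that is, to x being in z^-1 eta_t z. Every t below
   tip(nu) is below a; conversely both nu(x) and a /\ eta(z x z^-1) lie below
   tip(nu) = a /\ tip(eta), so the level equality may be used at these two
   values of t, which gives the two inequalities between nu and the conjugate. *)
Require Import Defs.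
From mathcomp Require Import all_boot all_order.
From mathcomp Require Import boolp classical_sets.

Import Order.LTheory.

Lemma lsup_ubound (d : Order.disp_t) (L : tbLatticeType d) (A : set L) :
  complete_lattice L -> ubound A (lsup A).
Proof.
(* On the empty set [supremum] returns its default, and the bound is vacuous; otherwise completeness
   makes the chosen value a true supremum. *)
move=> hL; rewrite /lsup /supremum; case: eqP => [-> x [] | _].
by have [[s hs] _] := hL A; have [] := xgetPex \bot%O (ex_intro _ s hs).
Qed.

Lemma le_tip (d : Order.disp_t) (L : tbLatticeType d) (G : groupType)
    (eta : G -> L) (x : G) :
  complete_lattice L -> (eta x <= tip eta)%O.
Proof. by move=> hL; apply: lsup_ubound => //; exists x. Qed.

(** Conjugation is bijective, so the image has only one possible preimage of [x]. *)
Lemma mem_set_conjV (G : groupType) (K : set G) (z x : G) :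
  set_conj K (z^-1)%g x <-> K (z * x * z^-1)%g.
Proof.
rewrite /set_conj /= invgK; split=> [[y Ky <-] | Kx].
  by rewrite !mulgA mulgV mul1g mulgK.
by exists (z * x * z^-1)%g; rewrite // !mulgA mulVg mul1g mulgVK.
Qed.

Theorem theorem3p6 (d : Order.disp_t) (L : tbLatticeType d)
    (hL : completely_distributive L) (G : groupType)
    (mu : G -> L) (hmu : lsubgroup mu)
    (eta nu : G -> L) (heta : lsubgroup_of mu eta) (hnu : lsubgroup_of mu nu)
    (a : L) (htip : tip nu = (a `&` tip eta)%O)
    (z : G) (haz : lpoint_mem a z mu) :
  nu = lconj eta a z <->
  (forall t : L, (t <= tip nu)%O ->
     level nu t = set_conj (level eta t) (z^-1)%g).
Proof.
have [hC _] := hL.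
have tip_le_a : (tip nu <= a)%O by rewrite htip leIl.
split=> [nuE t t_le | levelE].
  apply/predeqP => x; rewrite mem_set_conjV /level /= nuE /lconj lexI.
  by rewrite (le_trans t_le tip_le_a).
have levelP t x : (t <= tip nu)%O ->
    (t <= nu x)%O <-> (t <= eta (z * x * z^-1)%g)%O.
  by move=> /levelE E; have := mem_set_conjV _ (level eta t) z x; rewrite -E.
apply/funext => x; apply/le_anti/andP; split; rewrite /lconj.
  (* Here [t] is [nu x], so the left side of [levelP] is reflexivity. *)
  have nux_le := le_tip _ _ _ nu x hC.
  by rewrite lexI (le_trans nux_le tip_le_a); apply/levelP.
(* Here [t] is the value of the conjugate at [x], below [tip nu] by monotonicity of the meet. *)
by apply/levelP; [rewrite htip leI2 // le_tip | rewrite leIr].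
Qed.
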